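(* Let $m\in\{1,2,\ldots\}$, $\mathcal{A}=[0,1]^m$, and let $\mathcal{S}$ be a measurable state space. Let $\alpha\in(0,\infty)$ and $L<\infty$, and let $f:\mathcal{S}\times\mathcal{A}\to\mathbb{R}^+$ be such that for every $s\in\mathcal{S}$ the function $a\mapsto f(s,a)$ is $\alpha$-smooth on $\mathcal{A}$ with $\|f(s,\cdot)\|_{C^\alpha}\le L$. Then there is a constant $c$ depending only on $m$ and $\alpha$ such that, for every probability distribution $\rho$ on $\mathcal{S}$ and every policy $\pi$, $$\mathbb{E}_{s\sim\rho,\,a\sim\pi(\cdot\mid s)}[f(s,a)]\;\le\; c\,L^{\frac{m}{m+\alpha}}\Big(\mathbb{E}_{s\sim\rho,\,a\sim\mathrm{unif}_{\mathcal{A}}}[f(s,a)]\Big)^{\frac{\alpha}{m+\alpha}}.$$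
   Context: $\mathbb{R}^+$ denotes the positive reals. $\mathrm{unif}_{\mathcal{A}}$ is the uniform distribution on $\mathcal{A}=[0,1]^m$. A policy $\pi$ assigns to each state $s$ a probability distribution $\pi(\cdot\mid s)$ on $\mathcal{A}$. Functions are assumed measurable. For $\alpha>0$, $\lfloor\alpha\rfloor$ denotes the largest integer strictly smaller than $\alpha$ (so $\lfloor 5\rfloor=4$), and $\{\alpha\}=\alpha-\lfloor\alpha\rfloor\in(0,1]$. For a multi-index $\beta\in\mathbb{N}^m$ with $|\beta|=\sum_i\beta_i$, $D^\beta f$ denotes the corresponding mixed partial derivative, and $\nabla^j f$ is the vector of all $D^\beta f$ with $|\beta|=j$ ($\nabla^0 f=f$). A function $g:\mathcal{D}\to\mathbb{R}$, $\mathcal{D}\subseteq\mathbb{R}^m$, is $\alpha$-smooth if its mixed derivatives of order $\lfloor\alpha\rfloor$ exist and there is a constant $L$ such that (1) $\|\nabla^j g\|_\infty\le L$ for all $j\le\lfloor\alpha\rfloor$, where $\|\cdot\|_\infty$ is the essential supremum over $\mathcal D$ of the (Euclidean) norm; and (2) $\sup_{a\ne a'\in\mathcal{D},\,|\beta|=\lfloor\alpha\rfloor}\frac{|D^\beta g(a)-D^\beta g(a')|}{\|a-a'\|_2^{\{\alpha\}}}\le L$. The norm $\|g\|_{C^\alpha}$ is the minimum $L\ge0$ for which (1) and (2) hold. *)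

(* Defs.v *)
From HB Require Import structures.
From mathcomp Require Import all_boot all_order all_algebra.
From mathcomp Require Import all_classical all_reals all_analysis.
From mathcomp Require Import ess_sup_inf.

Set Implicit Arguments.
Unset Strict Implicit.
Unset Printing Implicit Defensive.

Import Order.TTheory GRing.Theory Num.Theory.
Import numFieldNormedType.Exports.

Local Open Scope classical_set_scope.
Local Open Scope ring_scope.

(* R^m as a measurable space: the library equips n.-tuple T with the product
   sigma-algebra, and measurableTypeR R is R with its Borel sets. *)
Notation "''Rm[' R ]_ m" := (m.-tuple (measurableTypeR R))
  (at level 8, m at level 2, format "''Rm[' R ]_ m") : type_scope.

Definition cube (R : realType) (m : nat) : set 'Rm[R]_m :=
  [set a | forall i, 0 <= tnth a i <= 1].
Arguments cube : clear implicits.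

Section uniform_measure.
Context (R : realType).

Definition cons_pair (n : nat) (x : measurableTypeR R * 'Rm[R]_n) :
  'Rm[R]_n.+1 := [tuple of x.1 :: x.2].

Lemma measurable_cons_pair (n : nat) : measurable_fun setT (@cons_pair n).
Proof.
apply: (@measurable_cons _ _ _ _ fst n snd).
- exact: measurable_fst.
- exact: measurable_snd.
Qed.

HB.instance Definition _ (n : nat) :=
  isMeasurableFun.Build _ _ _ _ (@cons_pair n) (@measurable_cons_pair n).

(* The library has only binary product measures, so the m-fold product of the
   uniform law on [0, 1] is built by transporting (unif [0,1]) \x (unif [0,1]^n)
   along R * R^n = R^(n+1). *)
Fixpoint unif (m : nat) : probability 'Rm[R]_m R :=
  match m with
  | 0%N => \d_([tuple] : 'Rm[R]_0)
  | n.+1 => distribution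
      (uniform_prob (@ltr01 R) \x unif n : probability _ R)%E (@cons_pair n)
  end.

End uniform_measure.
Arguments unif : clear implicits.

Lemma unif_box (R : realType) (m : nat) (B : 'I_m -> set (measurableTypeR R)) :
  (forall i, measurable (B i)) ->
  unif R m [set a | forall i, B i (tnth a i)] =
  (\prod_(i < m) uniform_prob (@ltr01 R) (B i))%E.
Proof.
elim: m B => [|n IH] B mB.
  rewrite big_ord0 /= diracE mem_set//.
  by move=> [].
rewrite big_ord_recl /= -(IH (fun i => B (lift ord0 i)))//.
set C := [set a : 'Rm[R]_n | _].
have mC : measurable C.
  rewrite (_ : C = \bigcap_(i in [set: 'I_n])
      ((fun a : 'Rm[R]_n => tnth a i) @^-1` B (lift ord0 i))); last first.
    by apply/seteqP; split => a Ca i; [move=> _|]; exact: Ca.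
  apply: fin_bigcap_measurable; first exact: finite_finset.
  by move=> i _; rewrite -[X in measurable X]setTI; exact: measurable_tnth.
rewrite /distribution /pushforward -[RHS]product_measure1E//.
congr (product_measure1 _ _ _).
apply/seteqP; split => -[x a] /= => [H|[Bx Ca] i].
  split; first exact: (H ord0).
  by move=> i; have := H (lift ord0 i); rewrite /cons_pair tnthS.
have [j ->|->] := unliftP ord0 i; last exact: Bx.
by rewrite /cons_pair tnthS; exact: Ca.
Qed.

Lemma unif_cube (R : realType) (m : nat) : unif R m (cube R m) = 1%E.
Proof.
rewrite (_ : cube R m =
    [set a | forall i, (fun=> `[0, 1]%classic : set (measurableTypeR R)) i (tnth a i)]).
  rewrite (@unif_box _ _ (fun=> `[0, 1]%classic)); last by move=> i; exact: measurable_itv.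
  rewrite big1// => i _.
  by rewrite /uniform_prob integral_uniform_pdf1//; exact: ltr01.
by apply/seteqP; split => a H i; have := H i; rewrite /= in_itv.
Qed.

(* The largest integer strictly smaller than alpha; see floorS_itv. *)
Definition floorS (R : realType) (alpha : R) : nat := `|Num.ceil alpha - 1|%N.

Definition fracS (R : realType) (alpha : R) : R := alpha - (floorS alpha)%:R.

Lemma floorS_itv (R : realType) (alpha : R) : 0 < alpha ->
  (floorS alpha)%:R < alpha <= (floorS alpha).+1%:R.
Proof.
move=> a0; have c0 : 0 <= Num.ceil alpha - 1 by rewrite subr_ge0 -gtz0_ge1 ceil_gt0.
have -> : (floorS alpha)%:R = (Num.ceil alpha - 1)%:~R :> R.
  by rewrite /floorS -[in RHS](gez0_abs c0) pmulrn.
have -> : (floorS alpha).+1%:R = (Num.ceil alpha)%:~R :> R.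
  have <- : (`|Num.ceil alpha - 1|%N)%:Z + 1 = Num.ceil alpha.
    by rewrite gez0_abs// subrK.
  by rewrite /floorS rmorphD/= natr1.
by rewrite ceil_itv.
Qed.

Section smoothness.
Context (R : realType) (m : nat).
Implicit Types (g : 'Rm[R]_m -> R) (a : 'Rm[R]_m) (alpha L : R).

Definition eucl_dist (a a' : 'Rm[R]_m) : R :=
  Num.sqrt (\sum_(i < m) (tnth a i - tnth a' i) ^+ 2).

Definition update (a : 'Rm[R]_m) (i : 'I_m) (t : R) : 'Rm[R]_m :=
  [tuple if j == i then t else tnth a j | j < m].

(* Partial derivatives of functions on the cube: the i-th coordinate only moves
   inside [0, 1], so the derivative is one-sided on the faces of the cube, and
   the values of g outside the cube play no role. *)
Definition diff_quot (i : 'I_m) g a (t : R) : R :=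
  (g (update a i t) - g a) / (t - tnth a i).

Definition partial_filter (i : 'I_m) a : set_system R :=
  within `[0, 1] (dnbhs (tnth a i : R)).

Definition partial (i : 'I_m) g a : R :=
  lim (diff_quot i g a t @[t --> partial_filter i a]).

Definition has_partial (i : 'I_m) g : Prop :=
  forall a, cube R m a -> cvg (diff_quot i g a t @[t --> partial_filter i a]).

(* Derivative along a word of coordinates; the last letter acts first. *)
Definition Dword (w : seq 'I_m) g : 'Rm[R]_m -> R := foldr partial g w.

Fixpoint has_Dword (w : seq 'I_m) g : Prop :=
  match w with
  | [::] => True
  | i :: v => has_Dword v g /\ has_partial i (Dword v g)
  end.

(* Multi-indices of order j; their entries are at most j. *)
Definition multi (j : nat) := {ffun 'I_m -> 'I_j.+1}.

Definition order_of (j : nat) (beta : multi j) : nat := (\sum_(i < m) beta i)%N.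

(* D^beta = d_0^(beta 0) ... d_(m-1)^(beta (m-1)); once all the derivatives of
   order floorS alpha exist and (2) below holds, they do not depend on the
   order of differentiation. *)
Definition Dmulti (j : nat) (beta : multi j) g : 'Rm[R]_m -> R :=
  Dword (flatten [seq nseq (beta i) i | i <- enum 'I_m]) g.

Definition grad_norm (j : nat) g a : R :=
  Num.sqrt (\sum_(beta : multi j | order_of beta == j) Dmulti beta g a ^+ 2).

Definition derivatives_exist (k : nat) g : Prop :=
  forall w : seq 'I_m, size w = k -> has_Dword w g.

(* Conditions (1) and (2) below are the two bounds defining the C^alpha norm.
   Since unif is Lebesgue measure on the cube, ess_sup (unif R m) is the
   essential supremum over the cube. *)
Definition Calpha_bound alpha g L : Prop :=
  (* (1) *)
  (forall j : nat, (j <= floorS alpha)%N ->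
     (ess_sup (unif R m) (fun a => (grad_norm j g a)%:E) <= L%:E)%E) /\
  (* (2) *)
  (forall beta : multi (floorS alpha), order_of beta = floorS alpha ->
   forall a a', cube R m a -> cube R m a' -> a <> a' ->
     `|Dmulti beta g a - Dmulti beta g a'| / eucl_dist a a' `^ fracS alpha <= L).

Definition alpha_smooth alpha g : Prop :=
  derivatives_exist (floorS alpha) g /\ exists L, Calpha_bound alpha g L.

(* The infimum is attained because the bounds are closed conditions on L. For a
   function that is not alpha_smooth the value is meaningless. *)
Definition Calpha_norm alpha g : R :=
  inf [set L | 0 <= L /\ Calpha_bound alpha g L].

End smoothness.

(* E_{s ~ rho, a ~ pi(.|s)} [f(s, a)], for nonnegative f. *)
Definition expected d (S : measurableType d) (R : realType) (m : nat)
    (rho : probability S R) (pi : S -> {measure set 'Rm[R]_m -> \bar R})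
    (f : S -> 'Rm[R]_m -> R) : \bar R :=
  (\int[rho]_s \int[pi s]_(a in cube R m) (f s a)%:E)%E.

(* Main.v *)
(* Pure derivatives along the coordinate axes suffice. Put k = floorS alpha. By
   the mean value theorem and the Hoelder bound on d_i^k f, the (k+1)-st finite
   difference of step h along any axis is at most L |h|^alpha. Hence f at a
   point is at most a fixed linear combination of its values at the k+1 next
   points of the progression, plus L |h|^alpha; averaging over |h| of order r
   and treating one coordinate after the other gives, for 0 < r <= 1/2,
     f(s, a) <= C r^(-m) int f(s, .) + D L r^alpha.
   This is integrated against the policy and rho with r independent of s, so
   that no concavity argument is needed, and then r is chosen proportional to
   (A / L)^(1 / (m + alpha)), where A <= L is the uniform expectation. *)
Require Import Defs.
From mathcomp Require Import all_boot all_order all_algebra.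
From mathcomp Require Import all_classical all_reals all_analysis.
From mathcomp Require Import measurable_realfun ess_sup_inf ring lra.
Set Implicit Arguments.
Unset Strict Implicit.
Unset Printing Implicit Defensive.
Import Order.TTheory GRing.Theory Num.Theory.
Import numFieldNormedType.Exports.
Local Open Scope classical_set_scope.
Local Open Scope ring_scope.

(** * Finite differences on the line and their Hoelder bound *)

Section finite_differences.
Context (R : realType).
Implicit Types (u v : R -> R) (x h : R).

(** The function is differenced first, so that inductions on n may replace u by its difference;
    [fdiffS] supplies the recursion on the outside. *)
Fixpoint fdiff (n : nat) h u : R -> R :=
  if n is n'.+1 then fdiff n' h (fun y => u (y + h) - u y) else u.

Lemma fdiffB n h u v x :
  fdiff n h (fun y => u y - v y) x = fdiff n h u x - fdiff n h v x.
Proof.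
elim: n u v => //= n IH u v; rewrite -IH; congr (fdiff n h _ x).
by apply/funext => y; ring.
Qed.

Lemma fdiff_shift n h u x c :
  fdiff n h (fun y => u (y + c)) x = fdiff n h u (x + c).
Proof.
elim: n u => //= n IH u; rewrite -(IH (fun y => u (y + h) - u y)).
by congr (fdiff n h _ x); apply/funext => y; rewrite addrAC.
Qed.

Lemma fdiffS n h u x :
  fdiff n.+1 h u x = fdiff n h u (x + h) - fdiff n h u x.
Proof. by rewrite /= fdiffB fdiff_shift. Qed.

Lemma fdiffN n h u x :
  fdiff n (- h) u x = (-1) ^+ n * fdiff n h u (x - h *+ n).
Proof.
elim: n x => [|n IH] x; first by rewrite mul1r mulr0n subr0.
rewrite !fdiffS !IH mulrS opprD addrA.
rewrite (_ : x - h - h *+ n + h = x - h *+ n); last by ring.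
by rewrite exprS; ring.
Qed.

Lemma fdiff_le n h u x :
  `|fdiff n h u x| <= 2 ^+ n * \sum_(j < n.+1) `|u (x + h *+ j)|.
Proof.
elim: n u x => [|n IH] u x; first by rewrite big_ord1 mul1r mulr0n addr0.
rewrite fdiffS (le_trans (ler_normB _ _))// exprS -mulrA mulr_natl mulr2n.
apply: lerD; apply: (le_trans (IH _ _)); rewrite ler_wpM2l ?exprn_ge0//.
  rewrite [leRHS]big_ord_recl/= -[leLHS]add0r lerD//.
  by apply: ler_sum => j _; rewrite -addrA -mulrS.
by rewrite [leRHS]big_ord_recr/= lerDl.
Qed.

(** Lets a function be altered off the progression, in particular outside the cube. *)
Lemma eq_fdiff n h u v x :
  (forall j, (j <= n)%N -> u (x + h *+ j) = v (x + h *+ j)) ->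
  fdiff n h u x = fdiff n h v x.
Proof.
move=> uv; apply/eqP; rewrite -subr_eq0 -fdiffB -normr_le0.
apply: (le_trans (fdiff_le _ _ _ _)); rewrite big1 ?mulr0// => j _.
by rewrite uv ?subrr ?normr0// -ltnS.
Qed.

Lemma itv_arith_prog n h x j : (j <= n)%N ->
  0 <= x <= 1 -> 0 <= x + h *+ n <= 1 -> 0 <= x + h *+ j <= 1.
Proof.
move=> jn; have [h0|/ltW h0] := leP 0 h.
  have := ler_wpMn2l h0 jn; have := mulrn_wge0 j h0; lra.
have := ler_wnMn2l h0 jn; have := mulrn_wle0 j h0; lra.
Qed.

(** Going from n to n+1, the n-th difference at x equals the n-th difference at x + h minus the
    (n+1)-st at x, and the former involves only later points. Hence x itself is absent from the sum
    on the right. *)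
Lemma le_fdiff n h u x :
  `|u x| <= `|fdiff n h u x| + 2 ^+ n * \sum_(j < n) `|u (x + h *+ j.+1)|.
Proof.
elim: n => [|n IH]; first by rewrite big_ord0 mulr0 addr0.
apply: (le_trans IH); rewrite exprS mulr_natl mulr2n mulrDl addrA.
set S := \sum_(j < n) _; set T := \sum_(j < n.+1) _.
have ST : 2 ^+ n * S <= 2 ^+ n * T.
  by rewrite ler_wpM2l ?exprn_ge0// /T big_ord_recr/= lerDl.
apply: lerD => //.
have A : `|fdiff n h u (x + h)| <= 2 ^+ n * T.
  apply: (le_trans (fdiff_le _ _ _ _)).
  by under eq_bigr do rewrite -addrA -mulrS.
have := ler_normB (fdiff n h u (x + h)) (fdiff n.+1 h u x).
by rewrite fdiffS opprB addrCA subrr addr0; lra.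
Qed.

(** The regularity that [MVT] asks for: one-sided derivatives at the ends enter only through
    continuity. *)
Definition diff_on lo hi u u1 :=
  {within `[lo, hi], continuous u} /\
  forall t, t \in `]lo, hi[ -> is_derive t 1 u (u1 t).

Lemma diff_on_fdiff lo hi h u u1 : 0 < h -> diff_on lo hi u u1 ->
  diff_on lo (hi - h) (fun y => u (y + h) - u y) (fun y => u1 (y + h) - u1 y).
Proof.
move=> h0 [cu du]; have cu' : {within `[lo, hi - h], continuous u}.
  apply: continuous_subspaceW cu => t; rewrite /= !in_itv/=; lra.
split; last first.
  move=> t; rewrite in_itv/= => tI.
  have ? : is_derive t 1 u (u1 t) by apply: du; rewrite in_itv/=; lra.
  have ? : is_derive (t + h) 1 u (u1 (t + h)) by apply: du; rewrite in_itv/=; lra.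
  have duh : is_derive t 1 (fun y => u (y + h)) (u1 (t + h)).
    rewrite -[u1 (t + h)]mulr1.
    have := @is_derive_shift R t 1 h.
    by move=> ?; apply: (@is_derive1_comp _ u (shift h)).
  exact: (@is_deriveB _ _ _ (fun y => u (y + h)) u).
have : {within `[lo, hi - h], continuous (fun y => u (y + h))}.
  apply/subspace_continuousP => t /= tI.
  move/subspace_continuousP : cu => /(_ (t + h)) cu.
  apply: (cvg_comp (fun y => y + h) u) _ (cu _).
    move=> P [e /= e0 eP]; exists e => //= y yt yI; apply: eP => /=.
      by rewrite opprD addrACA subrr addr0.
    by move: yI; rewrite /= !in_itv/=; lra.
  by move: tI; rewrite /= !in_itv/=; lra.
by move=> cuh x; apply: continuousB; [exact: cuh|exact: cu'].
Qed.

(** Multiplying the quotient by y - t gives continuity up to the ends. At an interior point, the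
    part of [0, 1] near t is a full neighbourhood, so the limit is the two-sided derivative. *)
Lemma diff_on_within u u1 :
  (forall t, t \in `[0, 1] ->
     (u y - u t) / (y - t) @[y --> within `[0, 1] t^'] --> u1 t) ->
  diff_on 0 1 u u1.
Proof.
move=> du; split.
  apply/subspace_continuousP => t tI.
  have : (u y - u t) / (y - t) * (y - t) @[y --> within `[0, 1] t^'] --> u1 t * 0.
    apply: cvgM; first exact: du.
    rewrite -(subrr t); apply: cvgB; last exact: cvg_cst.
    apply: cvg_within_filter; apply: cvg_within_filter; exact: cvg_id.
  rewrite mulr0 => /cvgrPdist_lt H; apply/cvgrPdist_lt => e e0.
  have [d /= d0 He] := H e e0; exists d => //= y yt yI.
  have [->|yNt] := eqVneq y t; first by rewrite subrr normr0.
  have := He y yt yNt yI; rewrite divfK ?subr_eq0//.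
  by rewrite add0r opprB.
move=> t; rewrite in_itv/= => tI.
have H : h^-1 *: (u (h *: 1 + t) - u t) @[h --> 0^'] --> u1 t.
  have tI' : t \in `[0, 1] by rewrite in_itv/=; lra.
  apply: cvg_trans (du t tI') => P [d /= d0 dP].
  have e0 : 0 < Num.min d (Num.min t (1 - t)) by rewrite !lt_min; lra.
  exists (Num.min d (Num.min t (1 - t))) => //= h.
  rewrite /= sub0r normrN !lt_min => /and3P[hd ht ht1] hN0.
  have := dP (h + t); rewrite /= opprD addrCA subrr addr0 normrN => /(_ hd).
  rewrite -subr_eq0 addrK => /(_ hN0); rewrite in_itv/=.
  have -> : 0 <= h + t <= 1 by move: ht ht1; rewrite !ltr_norml; lra.
  by rewrite /shift/= [h *: 1]mulr1 mulrC; exact.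
apply: DeriveDef.
  by apply/cvg_ex; exists (u1 t).
exact: cvg_lim H.
Qed.

(** One difference is absorbed into the whole family U, at the cost of shortening the interval by h.
    The induction hypothesis then leaves a single difference of [U n], to which the mean value
    theorem applies. *)
Lemma fdiff_mean_value n (U : nat -> R -> R) lo hi h x : 0 < h ->
  (forall j, (j < n)%N -> diff_on lo hi (U j) (U j.+1)) ->
  lo <= x -> x + h *+ n <= hi ->
  exists2 xi, x <= xi <= x + h *+ n & fdiff n h (U 0) x = h ^+ n * U n xi.
Proof.
move=> h0; elim: n U hi => [|n IH] U hi dU lox xhi.
  by exists x; rewrite ?mulr0n ?addr0 ?lexx// mul1r.
have [||xi xiI fE] := IH (fun j y => U j (y + h) - U j y) (hi - h) _ lox.
- by move=> j jn; apply: diff_on_fdiff => //; apply: dU; rewrite ltnS ltnW.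
- by rewrite lerBrDr -addrA -mulrSr.
have [cU dU1] := dU n (ltnSn n).
have sub : `[xi, xi + h] `<=` `[lo, hi].
  by move=> t; rewrite /= !in_itv/= => /andP[]; move: xiI xhi; rewrite mulrS; lra.
have lxi : xi < xi + h by rewrite ltrDl.
have dxi t : t \in `]xi, xi + h[ -> is_derive t 1 (U n) (U n.+1 t).
  rewrite in_itv/= => /andP[t1 t2]; apply: dU1; rewrite in_itv/=.
  by move: xiI xhi => /andP[]; rewrite mulrS; move: (h *+ n) => y; lra.
have [c] := MVT lxi dxi (continuous_subspaceW sub cU).
rewrite in_itv/= => cI UE; exists c.
  by move: xiI cI; rewrite mulrS; move: (h *+ n) => y; lra.
by rewrite /= fE UE exprS; ring.
Qed.

(** Only k of the k+1 differences are turned into derivatives; the last one remains as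
    [U k (xi + h) - U k xi], which the Hoelder condition controls. *)
Lemma fdiff_holder k (U : nat -> R -> R) L gamma x h :
  (forall j, (j < k)%N -> diff_on 0 1 (U j) (U j.+1)) ->
  (forall y z, 0 <= y <= 1 -> 0 <= z <= 1 ->
    `|U k y - U k z| <= L * `|y - z| `^ gamma) ->
  0 <= x <= 1 -> 0 <= x + h *+ k.+1 <= 1 -> 0 <= L ->
  `|fdiff k.+1 h (U 0) x| <= L * `|h| `^ (k%:R + gamma).
Proof.
move=> dU hU x01 xh01 L0.
have [->|hN0] := eqVneq h 0.
  by rewrite fdiffS addr0 subrr normr0 mulr_ge0 ?powR_ge0.
(* A progression with negative step is read from its last point; by [fdiffN] this changes only the
   sign. *)
wlog h0 : x h x01 xh01 hN0 / 0 < h => [H|].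
  have [|hle0] := ltP 0 h; first exact: H.
  have := H (x + h *+ k.+1) (- h) xh01; rewrite oppr_eq0 normrN mulNrn addrK.
  move=> /(_ x01 hN0); rewrite oppr_gt0 lt_neqAle hN0 hle0 => /(_ isT).
  by rewrite fdiffN normrM normrX normrN1 expr1n mul1r addrK.
have [|||xi xiI /= ->] :=
  @fdiff_mean_value k (fun j y => U j (y + h) - U j y) 0 (1 - h) h x h0.
- by move=> j jk; apply: diff_on_fdiff => //; exact: dU.
- by case/andP: x01.
- by rewrite lerBrDr -addrA -mulrSr; case/andP: xh01.
rewrite normrM normrX (gtr0_norm h0) powRD ?hN0 ?implybT// powR_mulrn ?(ltW h0)//.
rewrite [leRHS]mulrCA ler_wpM2l ?exprn_ge0 ?(ltW h0)//.
have := hU (xi + h) xi; rewrite (addrAC xi) subrr add0r (gtr0_norm h0); apply.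
  by move: x01 xh01 xiI; rewrite mulrS; move: (h *+ k) => y; lra.
by move: x01 xh01 xiI; rewrite mulrS; move: (h *+ k) => y; lra.
Qed.

End finite_differences.

(** * Restriction of smooth functions to lines parallel to the axes *)

Section coordinate_sections.
Context (R : realType) (m : nat).
Implicit Types (g : 'Rm[R]_m -> R) (a : 'Rm[R]_m).

Lemma tnth_update a i j t :
  tnth (update a i t) j = if j == i then t else tnth a j.
Proof. by rewrite tnth_mktuple. Qed.

Lemma update_update a i t t' : update (update a i t) i t' = update a i t'.
Proof.
by apply: eq_from_tnth => j; rewrite !tnth_update; case: eqP.
Qed.

Lemma cube_update a i t : cube R m a -> 0 <= t <= 1 -> cube R m (update a i t).
Proof. by move=> ca t01 j; rewrite tnth_update; case: eqP. Qed.

Lemma eucl_dist_update a i t t' :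
  eucl_dist (update a i t) (update a i t') = `|t - t'|.
Proof.
rewrite /eucl_dist (bigD1 i)//= big1 ?addr0; last first.
  by move=> j /negPf ji; rewrite !tnth_update ji subrr expr0n.
by rewrite !tnth_update eqxx sqrtr_sqr.
Qed.

Lemma diff_on_partial g i a : has_partial i g -> cube R m a ->
  diff_on 0 1 (fun t => g (update a i t)) (fun t => partial i g (update a i t)).
Proof.
move=> gi ca; apply: diff_on_within => t; rewrite in_itv/= => t01.
have /= := gi _ (cube_update i ca t01).
rewrite /partial /partial_filter /diff_quot tnth_update eqxx => H.
by under eq_fun do rewrite -(update_update a i t).
Qed.

Lemma has_Dword_cat v w g : has_Dword (v ++ w) g -> has_Dword w g.
Proof. by elim: v => //= i v IH [/IH]. Qed.

(** Carries the bounds stated for multi-indices over to pure derivatives: beta is concentrated at i,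
    so every other block of the flattened word is empty. *)
Lemma nseq_multi (k : nat) (i : 'I_m) : exists2 beta : multi m k,
  order_of beta = k & forall g, Dmulti beta g = Dword (nseq k i) g.
Proof.
exists [ffun j => if j == i then ord_max else ord0].
  rewrite /order_of (bigD1 i)//= ffunE eqxx big1 ?addn0// => j /negPf ji.
  by rewrite ffunE ji.
move=> g; rewrite /Dmulti; congr Dword.
have : i \in enum 'I_m by rewrite mem_enum.
elim: (enum 'I_m) (enum_uniq 'I_m) => //= j s IH /andP[js us].
rewrite inE ffunE; have [-> _|ij /= /(IH us) //] := eqVneq i j.
rewrite [X in _ ++ X](_ : _ = [::]) ?cats0//; elim: s js {IH us} => //= l s IH.
rewrite inE negb_or ffunE => /andP[jl /IH ->].
by rewrite eq_sym (negPf jl).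
Qed.

Lemma smooth_fdiff (alpha : R) g L i a x h :
  0 <= L -> derivatives_exist (floorS alpha) g ->
  Calpha_bound alpha g L -> cube R m a ->
  0 <= x <= 1 -> 0 <= x + h *+ (floorS alpha).+1 <= 1 ->
  `|fdiff (floorS alpha).+1 h (fun t => g (update a i t)) x| <= L * `|h| `^ alpha.
Proof.
move=> L0 gd [_ gh] ca x01 xh01; set k := floorS alpha in gd gh xh01 *.
have -> : alpha = k%:R + fracS alpha by rewrite /fracS addrC subrK.
pose U j t := Dword (nseq j i) g (update a i t).
have := @fdiff_holder R k U L (fracS alpha) x h; apply => //.
- move=> j jk; apply: diff_on_partial => //.
  (* Existence along a word of length k includes existence along its suffixes, hence of all lower
     pure derivatives. *)
  have /gd : size (nseq k i) = k by rewrite size_nseq.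
  by rewrite -(subnK jk) nseqD => /has_Dword_cat[].
- move=> y z y01 z01; have [beta bk bE] := nseq_multi k i.
  have [->|yz] := eqVneq y z; first by rewrite !subrr normr0 mulr_ge0 ?powR_ge0.
  have := gh beta bk _ _ (cube_update i ca y01) (cube_update i ca z01).
  rewrite eucl_dist_update bE ler_pdivrMr ?powR_gt0 ?normr_gt0 ?subr_eq0//.
  apply => /(congr1 (fun b => tnth b i)); rewrite !tnth_update eqxx.
  by apply/eqP.
Qed.

End coordinate_sections.

(** * Affine changes of variable and averaging over the step *)

Section averages.
Context (R : realType).
Local Notation mu := (@lebesgue_measure R).
Local Notation RB := (measurableTypeR R).

Definition affine (x c : R) : RB -> RB := fun t => x + c * t.

Lemma measurable_affine x c : measurable_fun setT (affine x c).
Proof.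
exact: (@measurable_funD _ _ _ _ (cst x) ( *%R c)).
Qed.

(** By uniqueness of Lebesgue measure it suffices to treat half-open intervals. A negative c
    exchanges the open and closed ends of the preimage, whence the two cases. *)
Lemma lebesgue_measure_affine x c (A : set RB) : c != 0 -> measurable A ->
  mu A = (`|c|%:E * mu (affine x c @^-1` A))%E.
Proof.
move=> c0 mA.
pose nu_ : {measure set RB -> \bar R} :=
  mscale (NngNum (normr_ge0 c)) (pushforward mu (affine x c)).
pose nu := nu_ (measurable_affine x c).
suff : mu A = nu A by [].
apply: lebesgue_measure_unique => // _ [[a b] _ <-].
rewrite /nu/nu_/= /mscale/= /pushforward.
have [cp|cn|/eqP] := ltgtP 0 c; last by rewrite eq_sym (negPf c0).
  have -> : affine x c @^-1` `]a, b] = `](a - x) / c, (b - x) / c]%classic.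
    apply/seteqP; split => t; rewrite /affine /= !in_itv/= ltr_pdivrMr// ler_pdivlMr//.
      by rewrite ltrBlDl lerBrDl mulrC.
    by rewrite ltrBlDl lerBrDl mulrC.
  rewrite !lebesgue_measure_itv/= !lte_fin ltr_pM2r ?invr_gt0// ltrD2r.
  case: ifPn; last by rewrite mule0.
  move=> ab; rewrite -!EFinB -EFinM gtr0_norm//; congr EFin.
  by field.
have -> : affine x c @^-1` `]a, b] = `[(b - x) / c, (a - x) / c[%classic.
  apply/seteqP; split => t; rewrite /affine /= !in_itv/= ltr_ndivlMr// ler_ndivrMr//.
    by rewrite ltrBlDl lerBrDl mulrC andbC.
  by rewrite ltrBlDl lerBrDl mulrC andbC.
rewrite !lebesgue_measure_itv/= !lte_fin ltr_nM2r ?invr_lt0// ltrD2r.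
case: ifPn; last by rewrite mule0.
move=> ab; rewrite -!EFinB -EFinM ltr0_norm//; congr EFin.
by field.
Qed.

Lemma ge0_integral_affine x c (D : set RB) (u : RB -> R) : c != 0 ->
  measurable D -> measurable_fun setT u -> (forall t, 0 <= u t) ->
  (\int[mu]_(t in affine x c @^-1` D) (u (affine x c t))%:E =
   (`|c|^-1)%:E * \int[mu]_(t in D) (u t)%:E)%E.
Proof.
move=> c0 mD mu_ u0.
pose nu_ : {measure set RB -> \bar R} :=
  mscale (NngNum (normr_ge0 c)) (pushforward mu (affine x c)).
pose nu := nu_ (measurable_affine x c).
have mU : measurable_fun D (EFin \o u) by apply/measurable_EFinP; exact: measurable_funTS.
have -> : (\int[mu]_(t in D) (u t)%:E = \int[nu]_(t in D) (u t)%:E)%E.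
  by apply: eq_measure_integral => A mA _; exact: lebesgue_measure_affine.
rewrite ge0_integral_mscale//=; last by move=> t _; rewrite lee_fin.
rewrite ge0_integral_pushforward//; last 2 first.
- exact: measurable_affine.
- by move=> t _; rewrite lee_fin.
by rewrite muleA -EFinM mulVf ?normr_eq0// mul1e.
Qed.

(* The average is confined to |t - x| <= r, a set of measure at most 2 r, so that
   in pointwise_bound the error terms of the other coordinates do not pick up
   a factor 1 / r. *)
Lemma fdiff_average n (r alpha K x : R) (u : RB -> R) :
  (0 < n)%N -> 0 < r -> r <= 2^-1 -> 0 <= alpha -> 0 <= K -> 0 <= x <= 1 ->
  measurable_fun setT u -> (forall t, 0 <= u t) ->
  (forall h, 0 <= x + h *+ n <= 1 -> `|fdiff n h u x| <= K * `|h| `^ alpha) ->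
  ((u x)%:E <= (K * r `^ alpha)%:E + (2 ^+ n * n%:R * n%:R / r)%:E *
     \int[mu]_(t in `[(x - r)%R, (x + r)%R] `&` `[0%R, 1%R]) (u t)%:E)%E.
Proof.
move=> n0 r0 r2 al0 K0 x01 mu_ u0 hu.
set J := _ `&` _; have mJ : measurable J by exact: measurableI.
(* As r is at most 1/2, at least one of the two directions stays inside [0, 1]. *)
have [c cr cI] : exists2 c : R, `|c| = r & 0 <= x + c <= 1.
  have [x2|x2] := leP x 2^-1; [exists r|exists (- r)].
  - by rewrite gtr0_norm.
  - by lra.
  - by rewrite normrN gtr0_norm.
  - by lra.
have n0' : 0 < n%:R :> R by rewrite ltr0n.
have conv s : 0 <= s <= 1 -> 0 <= x + c * s <= 1 by nra.
(* With step h = c t / n, the point x + (j+1) h is x + [d j] * t, affine in the averaging variable t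
   in [0, 1]. *)
pose d (j : 'I_n) := c * j.+1%:R / n%:R.
have dE j : `|d j| = r * (j.+1%:R / n%:R).
  by rewrite /d -mulrA normrM cr ger0_norm// divr_ge0.
have j1 (j : 'I_n) : 0 < j.+1%:R / n%:R :> R /\ j.+1%:R / n%:R <= 1 :> R.
  by rewrite divr_gt0// ler_pdivrMr// mul1r ler_nat; case: j.
have d0 j : d j != 0.
  by rewrite -normr_eq0 dE mulf_neq0 ?gt_eqF//; case: (j1 j).
pose II : set RB := `[0%R, 1%R]%classic.
have mII : measurable II by exact: measurable_itv.
have natM (k : nat) (y : \bar R) : (k%:R%:E * y = (y *+ k)%R)%E.
  elim: k => [|k IH]; first by rewrite mul0e mulr0n.
  by rewrite [RHS]mulrSr -natr1 EFinD ge0_muleDl ?lee_fin// IH mul1e.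
have muII : mu II = 1%E.
  by rewrite lebesgue_measure_itv/= lte_fin ltr01 -EFinB subr0.
have m01 (v : RB -> R) : measurable_fun setT v ->
    measurable_fun II (EFin \o v).
  by move=> mv; apply/measurable_EFinP; exact: measurable_funTS.
have mud j : measurable_fun setT (fun t => u (affine x (d j) t)).
  exact: (measurableT_comp mu_ (measurable_affine _ _)).
have pt (t : RB) : t \in II ->
    u x <= K * r `^ alpha + 2 ^+ n * \sum_(j < n) u (affine x (d j) t).
  rewrite inE /II/= in_itv/= => t01; pose h := c / n%:R * t.
  have := le_fdiff n h u x; rewrite ger0_norm// => /le_trans; apply; apply: lerD.
    apply: (le_trans (hu h _)).
      rewrite (_ : h *+ n = c * t) ?conv//.
      by rewrite -mulr_natr /h; field; rewrite gt_eqF.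
    rewrite ler_wpM2l// ge0_ler_powR ?nnegrE ?normr_ge0// ?(ltW r0)//.
    rewrite /h mulrAC -mulrA normrM cr ler_piMr ?(ltW r0)// ger0_norm.
      by rewrite ler_pdivrMr// mul1r (le_trans (andP t01).2)// ler1n.
    by rewrite divr_ge0 ?(andP t01).1// ltW.
  rewrite ler_wpM2l ?exprn_ge0// ler_sum// => j _; rewrite ger0_norm//.
  rewrite le_eqVlt; apply/orP; left; apply/eqP; congr (u _).
  by rewrite /affine /d /h -mulr_natr; ring.
(* The number u x is its own average over t in [0, 1], so [pt] can be integrated. *)
have -> : ((u x)%:E = \int[mu]_(t in II) cst (u x)%:E t)%E.
  by rewrite integral_cst//= muII mule1.
apply: (@le_trans _ _ (\int[mu]_(t in II) ((K * r `^ alpha)%:E +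
    (2 ^+ n)%:E * \sum_(j < n) (u (affine x (d j) t))%:E))%E).
  apply: ge0_le_integral => //.
  - by move=> t _; rewrite lee_fin.
  - apply: emeasurable_funD => //; apply: measurable_funeM.
    by apply: emeasurable_sum => j; exact: m01.
  by move=> t tI; rewrite sumEFin -EFinM -EFinD lee_fin pt// inE.
have sge0 t : (0 <= \sum_(j < n) (u (affine x (d j) t))%:E)%E.
  by apply: sume_ge0 => j _; rewrite lee_fin.
have smeas : measurable_fun II (fun t => \sum_(j < n) (u (affine x (d j) t))%:E)%E.
  by apply: emeasurable_sum => j; exact: m01.
rewrite ge0_integralD//; last 3 first.
- by move=> t _; rewrite lee_fin mulr_ge0// powR_ge0.
- by move=> t _; apply: mule_ge0; [rewrite lee_fin exprn_ge0|exact: sge0].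
- exact: measurable_funeM.
apply: leeD.
  by rewrite integral_cst//= muII mule1.
rewrite ge0_integralZl//.
rewrite ge0_integral_sum//; last 2 first.
- by move=> j; exact: m01.
- by move=> j t _; rewrite lee_fin.
rewrite -!mulrA EFinM -muleA lee_wpmul2l ?lee_fin ?exprn_ge0//.
rewrite (_ : (_ * _)%E = (\sum_(j < n) ((n%:R / r)%:E * \int[mu]_(t in J) (u t)%:E))%E); last first.
  by rewrite sumr_const card_ord -natM muleA -EFinM mulrA.
apply: lee_sum => j _.
(* The map sends [0, 1] into J, so the domain may be enlarged to the preimage of J before
   substituting. *)
apply: (@le_trans _ _ (\int[mu]_(t in affine x (d j) @^-1` J) (u (affine x (d j) t))%:E)%E).
  apply: ge0_subset_integral => //.
  - by rewrite -[X in measurable X]setTI; exact: measurable_affine.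
  - by apply/measurable_EFinP; exact: measurable_funTS.
  - by move=> t _; rewrite lee_fin.
  move=> t; rewrite /II/= in_itv/= => t01; rewrite /J/affine/= !in_itv/=.
  have [q0 q1] := j1 j; rewrite /d -(mulrA c) -(mulrA c).
  have s01 : 0 <= j.+1%:R / n%:R * t <= 1 by nra.
  split; last exact: conv.
  have : `|c * (j.+1%:R / n%:R * t)| <= r.
    by rewrite normrM cr ler_piMr ?(ltW r0)// ger0_norm; case/andP: s01.
  by rewrite ler_norml; lra.
rewrite ge0_integral_affine// lee_wpmul2r//.
  by apply: integral_ge0 => t _; rewrite lee_fin.
(* The Jacobian n / (r (j+1)) is at most n / r; the n summands account for the second factor n in
   the constant. *)
rewrite lee_fin dE invfM mulrC ler_wpM2r ?invr_ge0 ?(ltW r0)// invf_div.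
by rewrite ler_pdivrMr// ler_peMr ?ler1n// ltW.
Qed.

End averages.

(** * The pointwise bound on the cube *)

Section pointwise.
Context (R : realType).
Local Notation RB := (measurableTypeR R).

Lemma update_cons0 m (x t : RB) (b : 'Rm[R]_m) :
  update (cons_pair (x, b)) ord0 t = cons_pair (t, b).
Proof.
apply: eq_from_tnth => j; rewrite tnth_update.
have [i ->|->] := unliftP ord0 j; last by rewrite eqxx.
by rewrite eq_sym (negPf (neq_lift _ _)) !tnthS.
Qed.

Lemma update_consS m (x t : RB) (b : 'Rm[R]_m) (i : 'I_m) :
  update (cons_pair (x, b)) (lift ord0 i) t = cons_pair (x, update b i t).
Proof.
apply: eq_from_tnth => j; rewrite tnth_update.
have [k ->|->] := unliftP ord0 j; last by rewrite (negPf (neq_lift _ _)).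
by rewrite (inj_eq lift_inj) !tnthS tnth_update.
Qed.

Lemma cube_cons m (x : RB) (b : 'Rm[R]_m) :
  cube R m.+1 (cons_pair (x, b)) <-> 0 <= x <= 1 /\ cube R m b.
Proof.
split=> [H|[x01 H] i].
  split; first exact: (H ord0).
  by move=> i; have := H (lift ord0 i); rewrite tnthS.
by have [k ->|->] := unliftP ord0 i; rewrite ?tnthS.
Qed.

Lemma integral_unifS m (g : 'Rm[R]_m.+1 -> R) :
  measurable_fun setT g -> (forall a, 0 <= g a) ->
  (\int[unif R m.+1]_a (g a)%:E =
   \int[lebesgue_measure]_(x in `[0%R, 1%R])
     \int[unif R m]_b (g (cons_pair (x, b)))%:E)%E.
Proof.
move=> mg g0.
have mgc : measurable_fun setT (EFin \o (g \o @cons_pair R m)).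
  by apply/measurable_EFinP; exact: (measurableT_comp mg (@measurable_cons_pair R m)).
rewrite /= ge0_integral_distribution//; last by apply/measurable_EFinP.
rewrite fubini_tonelli1//; last by move=> z; rewrite /= lee_fin.
rewrite integral_uniform//.
- by rewrite subr0 invr1 mul1e.
- by apply: measurable_fun_fubini_tonelli_F => // z; rewrite lee_fin.
- by move=> x; apply: integral_ge0 => b _; rewrite lee_fin.
Qed.

(** Induction on the dimension: [fdiff_average] treats the first coordinate, and the induction
    hypothesis is applied on each slice where that coordinate is fixed. *)
Lemma pointwise_bound n m : (0 < n)%N ->
  exists C D : R, [/\ 0 <= C, 0 <= D & forall (r alpha K : R) (g : 'Rm[R]_m -> R),
    0 < r -> r <= 2^-1 -> 0 <= alpha -> 0 <= K ->
    measurable_fun setT g -> (forall a, 0 <= g a) ->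
    (forall i a x h, cube R m a -> 0 <= x <= 1 -> 0 <= x + h *+ n <= 1 ->
      `|fdiff n h (fun t => g (update a i t)) x| <= K * `|h| `^ alpha) ->
    forall a, cube R m a ->
    ((g a)%:E <= (C / r ^+ m)%:E * \int[unif R m]_b (g b)%:E +
      (D * K * r `^ alpha)%:E)%E].
Proof.
move=> n0; elim: m => [|m [C [D [C0 D0 IH]]]].
  exists 1, 0; split => // r alpha K g r0 _ _ _ mg g0 _ a _.
  rewrite !mul0r adde0 expr0 divr1 mul1e /= integral_dirac//; last exact/measurable_EFinP.
  by rewrite diracT mul1e (tuple0 a).
pose B : R := 2 ^+ n * n%:R * n%:R.
have B0 : 0 <= B by rewrite !mulr_ge0 ?exprn_ge0.
(* The factor B / r multiplies C / r^m in the main term. The new error is that of the first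
   coordinate plus B / r times the old error integrated over a set of measure at most 2 r. *)
exists (B * C), (1 + B * 2 * D); split; [exact: mulr_ge0| |].
  by rewrite addr_ge0// !mulr_ge0.
move=> r alpha K g r0 r2 al0 K0 mg g0 hg a; case/tupleP: a => x b.
rewrite -[[tuple of _]]/(cons_pair (x, b)) => /cube_cons[x01 cb].
have mfst : measurable_fun setT (fun y : RB => g (cons_pair (y, b))).
  have mb : measurable_fun setT (fun y : RB => (y, b)) by exact: pair2_measurable.
  exact: (measurableT_comp mg (measurableT_comp (@measurable_cons_pair R m) mb)).
pose G (y : RB) := (\int[unif R m]_b' (g (cons_pair (y, b')))%:E)%E.
have G0 y : (0 <= G y)%E by apply: integral_ge0 => b' _; rewrite lee_fin.
have mG : measurable_fun setT G.
  apply: (@measurable_fun_fubini_tonelli_F _ _ RB _ R (unif R m)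
    (EFin \o (g \o @cons_pair R m))) => [|z]; last by rewrite /= lee_fin.
  by apply/measurable_EFinP; exact: (measurableT_comp mg (@measurable_cons_pair R m)).
have GE y : 0 <= y <= 1 -> ((g (cons_pair (y, b)))%:E <=
    (C / r ^+ m)%:E * G y + (D * K * r `^ alpha)%:E)%E.
  have msec : measurable_fun setT (fun b' => g (cons_pair (y, b'))).
    have my : measurable_fun setT (pair y : _ -> RB * 'Rm[R]_m)%type.
      exact: pair1_measurable.
    exact: (measurableT_comp mg (measurableT_comp (@measurable_cons_pair R m) my)).
  move=> y01; apply: (IH r alpha K _ r0 r2 al0 K0 msec) => //.
  move=> i a z h ca z01 zh01; have := hg (lift ord0 i) (cons_pair (y, a)) z h.
  under eq_fun do rewrite update_consS.
  by apply => //; apply/cube_cons.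
have step := @fdiff_average R n r alpha K x (fun y => g (cons_pair (y, b)))
  n0 r0 r2 al0 K0 x01 mfst (fun _ => g0 _).
apply: (le_trans (step _)).
  move=> h xh01; have := hg ord0 (cons_pair (x, b)) x h.
  under eq_fun do rewrite update_cons0.
  by apply => //; apply/cube_cons.
rewrite -/B.
set J := _ `&` _; have mJ : measurable J by exact: measurableI.
pose I01 : set RB := `[0%R, 1%R]%classic.
pose I : \bar R := (\int[lebesgue_measure]_(y in I01) G y)%E.
have -> : (\int[unif R m.+1]_c (g c)%:E)%E = I by rewrite integral_unifS.
pose E : R := D * K * r `^ alpha.
have E0 : 0 <= E by rewrite !mulr_ge0 ?powR_ge0.
have Cr0 : 0 <= C / r ^+ m by rewrite divr_ge0 ?exprn_ge0 ?(ltW r0).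
(* Only the main term is enlarged from J to [0, 1]; the constant error keeps the small domain J. *)
have IJ : (\int[lebesgue_measure]_(t in J) (g (cons_pair (t, b)))%:E <=
    (C / r ^+ m)%:E * I + (E * (2 * r))%:E)%E.
  apply: (@le_trans _ _ (\int[lebesgue_measure]_(t in J)
      ((C / r ^+ m)%:E * G t + E%:E))%E).
    apply: ge0_le_integral => //.
    - by move=> t _; rewrite lee_fin.
    - by apply/measurable_EFinP; exact: measurable_funTS.
    - by apply: emeasurable_funD => //; apply: measurable_funeM; exact: measurable_funTS.
    - by move=> t [_]; rewrite /= in_itv/=; exact: GE.
  rewrite ge0_integralD//; last 2 first.
  - by move=> t _; apply: mule_ge0.
  - by apply: measurable_funeM; exact: measurable_funTS.
  rewrite ge0_integralZl//; last exact: measurable_funTS.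
  apply: leeD.
    rewrite lee_wpmul2l//; apply: ge0_subset_integral => //.
    - exact: measurable_itv.
    - exact: measurable_funTS.
    - by move=> t [].
  rewrite integral_cst//= [(E * _)%:E]EFinM lee_wpmul2l//.
  apply: (@le_trans _ _ (lebesgue_measure (`[(x - r)%R, (x + r)%R]%classic : set RB))).
    by apply: le_measure; rewrite ?inE//; move=> t [].
  rewrite lebesgue_measure_itv/= lte_fin; case: ifPn => _.
    by rewrite -EFinB lee_fin; lra.
  by rewrite lee_fin; lra.
have Br0 : 0 <= B / r by rewrite divr_ge0 ?(ltW r0).
have I0 : (0 <= I)%E by apply: integral_ge0 => t _; exact: G0.
apply: (@le_trans _ _ ((K * r `^ alpha)%:E + (B / r)%:E *
    ((C / r ^+ m)%:E * I + (E * (2 * r))%:E))%E).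
  by rewrite leeD2l// lee_wpmul2l.
rewrite ge0_muleDr; last 2 first.
- by apply: mule_ge0.
- by rewrite lee_fin (mulr_ge0 E0)// mulr_ge0// ltW.
rewrite muleA -!EFinM addeCA -EFinD; apply: leeD.
  rewrite le_eqVlt; apply/orP; left; apply/eqP; congr (_%:E * _)%E.
  by rewrite exprS; field; rewrite ?expf_neq0 gt_eqF.
rewrite lee_fin le_eqVlt; apply/orP; left; apply/eqP.
by rewrite /E; field; rewrite gt_eqF.
Qed.

End pointwise.

Lemma measurable_cube (R : realType) m : measurable (cube R m).
Proof.
rewrite (_ : cube R m = \bigcap_(i in [set: 'I_m])
    ((fun a : 'Rm[R]_m => tnth a i) @^-1` `[0, 1]%classic)).
  apply: fin_bigcap_measurable; first exact: finite_finset.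
  move=> i _; rewrite -[X in measurable X]setTI.
  by apply: measurable_tnth => //; exact: measurable_itv.
apply/seteqP; split => a ca i; first by move=> _; rewrite /= in_itv/=; exact: ca.
by have := ca i Logic.I; rewrite /= in_itv.
Qed.

(** * Consequences of a bound on the smoothness norm *)

Section calpha_norm.
Context (R : realType) (m : nat).
Implicit Types (g : 'Rm[R]_m -> R) (alpha L : R).

Lemma Calpha_boundW alpha g L L' :
  L <= L' -> Calpha_bound alpha g L -> Calpha_bound alpha g L'.
Proof.
move=> LL' [g1 g2]; split=> [j jk|beta bk a a' ca ca' aa'].
  by apply: (le_trans (g1 j jk)); rewrite lee_fin.
exact: le_trans (g2 beta bk a a' ca ca' aa') LL'.
Qed.

(** The infimum gives the bounds at L + e for every e > 0, and non-strict inequalities survive the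
    limit e -> 0. *)
Lemma Calpha_bound_norm alpha g L :
  alpha_smooth alpha g -> Calpha_norm alpha g <= L ->
  0 <= L /\ Calpha_bound alpha g L.
Proof.
move=> [_ [L1 gL1]] gL.
set A := [set L | 0 <= L /\ Calpha_bound alpha g L] in gL *.
(* Smoothness makes the set nonempty, so that its [inf] is a genuine infimum and not a default
   value. *)
have A0 : A !=set0.
  exists (Num.max 0 L1); split; first by rewrite le_max lexx.
  by apply: Calpha_boundW gL1; rewrite le_max lexx orbT.
have lbA : lbound A 0 by move=> x [].
have bound e : 0 < e -> Calpha_bound alpha g (L + e).
  move=> e0; have [x [x0 gx] xe] := inf_adherent e0 (conj A0 (ex_intro _ _ lbA)).
  by apply: Calpha_boundW gx; rewrite ltW// (lt_le_trans xe)// lerD2r.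
split; first by apply: le_trans gL; exact: lb_le_inf.
split=> [j jk|beta bk a a' ca ca' aa'].
  by apply/lee_addgt0Pr => e e0; rewrite -EFinD; exact: (bound e e0).1.
by apply/ler_addgt0Pr => e e0; exact: (bound e e0).2.
Qed.

Lemma le_grad_norm0 g a : (0 < m)%N -> `|g a| <= grad_norm 0 g a.
Proof.
move=> m0; have [beta b0 bE] := nseq_multi R 0 (Ordinal m0).
rewrite /grad_norm -sqrtr_sqr ler_wsqrtr// (bigD1 beta) ?b0//= bE lerDl.
by apply: sumr_ge0 => b _; exact: sqr_ge0.
Qed.

(** Condition (1) at j = 0 bounds the uniform expectation by L. The function u is merely dominated
    by |g|, so it can be the extension by zero of g from the cube. *)
Lemma integral_Calpha_bound alpha g (u : 'Rm[R]_m -> R) L :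
  (0 < m)%N -> 0 <= L -> Calpha_bound alpha g L ->
  measurable_fun setT u -> (forall a, 0 <= u a <= `|g a|) ->
  (\int[unif R m]_a (u a)%:E <= L%:E)%E.
Proof.
move=> m0 L0 [/(_ 0%N (leq0n _)) g1 _] mu ug.
have /ess_supP gL := g1.
have -> : (L%:E = \int[unif R m]_a cst L%:E a)%E.
  by rewrite integral_cst//= probability_setT mule1.
apply: ae_ge0_le_integral; rewrite /=.
- exact: measurableT.
- by move=> a _; rewrite lee_fin; case/andP: (ug a).
- exact/measurable_EFinP.
- by move=> a _; rewrite lee_fin.
- exact: measurable_cst.
- apply: filterS gL => a; rewrite /= lee_fin => gaL _; rewrite lee_fin.
  by apply: le_trans gaL; apply: le_trans (le_grad_norm0 _ _ m0); case/andP: (ug a).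
Qed.

End calpha_norm.

(** * Choice of the scale r *)

Lemma optimal_scale_bound (R : realType) (m : nat) (alpha C D A L : R) (Z : \bar R) :
  0 < alpha -> 0 <= C -> 0 <= D -> 0 <= A -> A <= L ->
  (forall r, 0 < r -> r <= 2^-1 ->
    (Z <= (C / r ^+ m * A + D * L * r `^ alpha)%:E)%E) ->
  (Z <= ((C * 2 ^+ m + D) * L `^ (m%:R / (m%:R + alpha)) *
     A `^ (alpha / (m%:R + alpha)))%:E)%E.
Proof.
move=> al0 C0 D0 A0 AL H.
have ma0 : 0 < m%:R + alpha by rewrite ltr_wpDl.
have L0 : 0 <= L := le_trans A0 AL.
(* For A = 0 the optimal scale degenerates: the main term vanishes and r is sent to 0, chosen so
   that D L r^alpha <= e. Adding 1 to D L keeps the denominator positive. *)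
move: A0; rewrite le_eqVlt => /orP[/eqP A0|A0].
  rewrite -A0 powR0 ?mulr0; last by rewrite mulf_neq0 ?invr_eq0 ?gt_eqF.
  apply/lee_addgt0Pr => e e0; rewrite add0e.
  have DL0 : 0 < D * L + 1 by rewrite ltr_wpDl// mulr_ge0.
  pose r := Num.min 2^-1 ((e / (D * L + 1)) `^ alpha^-1).
  have r0 : 0 < r by rewrite lt_min powR_gt0 ?divr_gt0//; lra.
  have r2 : r <= 2^-1 by rewrite ge_min lexx.
  apply: (le_trans (H r r0 r2)); rewrite -A0 mulr0 add0r lee_fin.
  have ra : r `^ alpha <= e / (D * L + 1).
    have -> : e / (D * L + 1) = ((e / (D * L + 1)) `^ alpha^-1) `^ alpha.
      by rewrite -powRrM mulVf ?gt_eqF// powRr1// ltW// divr_gt0.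
    by rewrite ge0_ler_powR ?nnegrE ?powR_ge0 ?(ltW r0) ?(ltW al0)// ge_min lexx orbT.
  apply: (@le_trans _ _ (D * L * (e / (D * L + 1)))).
    by rewrite ler_wpM2l ?mulr_ge0.
  by rewrite mulrA ler_pdivrMr// mulrC ler_wpM2l ?(ltW e0)//; lra.
have {}L0 : 0 < L := lt_le_trans A0 AL.
pose e := (m%:R + alpha)^-1.
have e0 : 0 < e by rewrite invr_gt0.
pose x := L `^ e; pose y := A `^ e.
have x0 : 0 < x by exact: powR_gt0.
have y0 : 0 < y by exact: powR_gt0.
have yx : y <= x by rewrite ge0_ler_powR ?nnegrE// ltW.
have powE z : 0 < z -> z = (z `^ e) ^+ m * (z `^ e) `^ alpha.
  move=> z0; rewrite -powR_mulrn ?powR_ge0// -powRD; last first.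
    by rewrite gt_eqF// powR_gt0.
  by rewrite -powRrM mulVf ?gt_eqF// powRr1// ltW.
have -> : L `^ (m%:R / (m%:R + alpha)) = x ^+ m.
  by rewrite mulrC powRrM powR_mulrn// powR_ge0.
have -> : A `^ (alpha / (m%:R + alpha)) = y `^ alpha by rewrite mulrC powRrM.
(* The scale is half of (A / L)^(1 / (m + alpha)); since y <= x it is at most 1/2. The halving
   produces the factor 2^m in the constant. *)
have r0 : 0 < y / x / 2 by rewrite !divr_gt0.
apply: (le_trans (H _ r0 _)).
  by rewrite ler_pdivrMr// mulVf// ler_pdivrMr// mul1r.
rewrite lee_fin -[leRHS]mulrA [leRHS]mulrDl; apply: lerD.
  rewrite (powE A A0) -/y !expr_div_n.
  rewrite le_eqVlt; apply/orP; left; apply/eqP; field.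
  by rewrite !expf_neq0 ?gt_eqF.
(* Writing L as x^m x^alpha turns L r^alpha into x^m (x r)^alpha, where x r = y / 2 <= y. *)
rewrite -mulrA ler_wpM2l// {1}(powE L L0) -/x -mulrA ler_wpM2l ?exprn_ge0 ?(ltW x0)//.
rewrite -powRM ?(ltW x0) ?(ltW r0)//.
have -> : x * (y / x / 2) = y / 2 by field; rewrite gt_eqF.
rewrite ge0_ler_powR ?nnegrE ?divr_ge0 ?(ltW y0) ?(ltW al0)//.
by rewrite ler_pdivrMr// ler_peMr ?(ltW y0)// ler1n.
Qed.

(** * Extension by zero and measurability of the expectations *)

Section expectation.
Context d (S : measurableType d) (R : realType) (m : nat).
Context (f : S -> 'Rm[R]_m -> R).
Context (mf : measurable_fun ([set: S] `*` cube R m) (fun x => f x.1 x.2)).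
Context (f0 : forall s a, cube R m a -> 0 < f s a).

(** Measurability and positivity of f are given only over the cube; the extension by zero is
    measurable and nonnegative everywhere. *)
Let F s := f s \_ (cube R m).

Lemma expectedE (rho : probability S R) (p : S -> {measure set 'Rm[R]_m -> \bar R}) :
  expected rho p f = (\int[rho]_s \int[p s]_a (F s a)%:E)%E.
Proof.
apply: eq_integral => s _; rewrite integral_mkcond; apply: eq_integral => a _.
by rewrite /F !patchE; case: ifP.
Qed.

Lemma patch_cube_ge0 s a : 0 <= F s a.
Proof. by rewrite /F patchE; case: ifPn => // /[1!inE] /f0 /ltW. Qed.

Lemma measurable_patch_cube : measurable_fun setT (fun x : S * 'Rm[R]_m => F x.1 x.2).
Proof.
have mSC : measurable ([set: S] `*` cube R m).
  by apply: measurableX => //; exact: measurable_cube.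
rewrite (_ : (fun _ => _) = (fun x => f x.1 x.2) \_ ([set: S] `*` cube R m)).
  exact/(measurable_restrictT _ mSC).
apply/funext => -[s a]; rewrite /F !patchE/=.
suff -> : ((s, a) \in [set: S] `*` cube R m) = (a \in cube R m) by [].
by apply/idP/idP; rewrite !inE/= => // -[].
Qed.

Lemma measurable_patch_cube1 s : measurable_fun setT (F s).
Proof.
have ms : measurable_fun setT (pair s : _ -> S * 'Rm[R]_m)%type.
  exact: pair1_measurable.
exact: (measurableT_comp measurable_patch_cube ms).
Qed.

End expectation.

(** * Integration against the policy and the state distribution *)

Theorem theorem1 (R : realType) (m : nat) (alpha : R)
    (hm : (0 < m)%N) (halpha : 0 < alpha) :
  exists c : R,
    forall (d : measure_display) (S : measurableType d) (L : R)
           (f : S -> 'Rm[R]_m -> R),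
      measurable_fun ([set: S] `*` cube R m) (fun x => f x.1 x.2) ->
      (forall s a, cube R m a -> 0 < f s a) ->
      (forall s, alpha_smooth alpha (f s) /\ Calpha_norm alpha (f s) <= L) ->
      forall (rho : probability S R) (policy : R.-pker S ~> 'Rm[R]_m),
        (forall s, policy s (cube R m) = 1%E) ->
        (expected rho policy f <=
         (c * L `^ (m%:R / (m%:R + alpha)))%:E *
         expected rho (fun=> unif R m) f `^ (alpha / (m%:R + alpha)))%E.
Proof.
have [C [D [C0 D0 CD]]] := @pointwise_bound R (floorS alpha).+1 m isT.
exists (C * 2 ^+ m + D) => d S L f mf f0 fL rho policy pcube.
pose F s := f s \_ (cube R m).
have F0 s a : 0 <= F s a := patch_cube_ge0 f0 s a.
have mF := measurable_patch_cube mf.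
have mF1 s : measurable_fun setT (F s) := measurable_patch_cube1 mf s.
have FC s a : cube R m a -> F s a = f s a by move=> ca; rewrite /F patchE mem_set.
have bnd s : 0 <= L /\ Calpha_bound alpha (f s) L.
  by have [? ?] := fL s; exact: Calpha_bound_norm.
pose I s := (\int[unif R m]_a (F s a)%:E)%E.
have I0 s : (0 <= I s)%E by apply: integral_ge0 => a _; rewrite lee_fin.
have IL s : (I s <= L%:E)%E.
  apply: (integral_Calpha_bound hm (bnd s).1 (bnd s).2 (mF1 s)) => a.
  by rewrite F0/= /F patchE; case: ifP; rewrite ?ler_norm ?normr_ge0.
have mI : measurable_fun setT I.
  apply: (@measurable_fun_fubini_tonelli_F _ _ S _ R (unif R m)
    (fun x => (F x.1 x.2)%:E)) => [|z]; last by rewrite lee_fin.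
  exact/measurable_EFinP.
(* Measurable spaces are pointed here, so there is a state from which L >= 0 can be read off. *)
have L0 : 0 <= L by exact: (bnd point).1.
pose A := (\int[rho]_s I s)%E.
have A0 : (0 <= A)%E by exact: integral_ge0.
have AL : (A <= L%:E)%E.
  apply: (@le_trans _ _ (\int[rho]_s cst L%:E s)%E).
    by apply: ge0_le_integral => //.
  by rewrite integral_cst//= probability_setT mule1.
have Afin : A \is a fin_num by rewrite ge0_fin_numE// (le_lt_trans AL) ?ltry.
have key r : 0 < r -> r <= 2^-1 ->
    (expected rho policy f <= (C / r ^+ m * fine A + D * L * r `^ alpha)%:E)%E.
  move=> r0 r2; rewrite expectedE.
  have Cr0 : 0 <= C / r ^+ m by rewrite divr_ge0 ?exprn_ge0 ?(ltW r0).
  have Dr0 : 0 <= D * L * r `^ alpha by rewrite !mulr_ge0 ?powR_ge0.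
  have pt s a : cube R m a ->
      ((F s a)%:E <= (C / r ^+ m)%:E * I s + (D * L * r `^ alpha)%:E)%E.
    move=> ca; apply: CD => //; first exact: ltW.
    move=> i b x h cb x01 xh01.
    (* The whole progression lies in [0, 1], where F and f agree, so the smoothness of f applies. *)
    rewrite (@eq_fdiff _ _ h _ (fun t => f s (update b i t))); last first.
      by move=> j jn; apply: FC; apply: cube_update => //; exact: itv_arith_prog xh01.
    by apply: smooth_fdiff => //; [exact: (fL s).1.1|exact: (bnd s).2].
  have bpt s : (\int[policy s]_a (F s a)%:E <=
      (C / r ^+ m)%:E * I s + (D * L * r `^ alpha)%:E)%E.
    set B := (_ + _)%E.
    (* The policy has mass 1 on the cube, so a bound by a constant passes to its integral. *)
    have -> : B = (\int[policy s]_(a in cube R m) cst B a)%E.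
      rewrite integral_cst; last exact: measurable_cube.
      by rewrite -[LHS]mule1; congr (_ * _)%E; rewrite -(pcube s).
    have -> : (\int[policy s]_a (F s a)%:E = \int[policy s]_(a in cube R m) (F s a)%:E)%E.
      rewrite [RHS]integral_mkcond; apply: eq_integral => a _.
      by rewrite /F !patchE; case: ifP.
    apply: ge0_le_integral => //.
    - exact: measurable_cube.
    - by move=> a _; rewrite lee_fin.
    - by apply/measurable_EFinP; exact: measurable_funTS.
    - by move=> a ca; exact: pt.
  have mp : measurable_fun setT (fun s => \int[policy s]_a (F s a)%:E)%E.
    apply: (@measurable_fun_integral_sfinite_kernel _ _ S _ R
      (fun x => (F x.1 x.2)%:E)) => [x|]; first by rewrite lee_fin.
    exact/measurable_EFinP.
  (* As r does not depend on s, the bound is affine in [I s] and integrates to one in A. *)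
  apply: (@le_trans _ _ (\int[rho]_s
      ((C / r ^+ m)%:E * I s + (D * L * r `^ alpha)%:E))%E).
    apply: ge0_le_integral => //.
    - by move=> s _; apply: integral_ge0 => a _; rewrite lee_fin; exact: F0.
    - by apply: emeasurable_funD => //; exact: measurable_funeM.
  rewrite ge0_integralD//; last 2 first.
  - by move=> s _; apply: mule_ge0; rewrite ?lee_fin.
  - exact: measurable_funeM.
  rewrite ge0_integralZl//= integral_cst//= probability_setT mule1.
  by rewrite EFinD [X in (_ <= X + _)%E]EFinM fineK.
have -> : expected rho (fun=> unif R m) f = (fine A)%:E by rewrite expectedE fineK.
rewrite poweR_EFin -EFinM; apply: optimal_scale_bound => //.
- exact: fine_ge0.
- by rewrite -lee_fin fineK.
Qed.
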